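(* Let $(\mathbb T,M,(-)^\circ,m)$ be an idealized monad on a category $\mathbf C$ with finite coproducts. Then: (1) $\mathbb T$ becomes an abstractly guarded monad when equipped with weak guardedness as the notion of abstract guardedness. (2) If $\mathbb T$ is completely iterative, then every weakly $\mathrm{inr}$-guarded morphism $f\colon X\to T(Y+X)$ has a unique solution, i.e. a unique $f^\dagger\colon X\to TY$ with $f^\dagger=[\eta,f^\dagger]^*\circ f$. (3) If $(\alpha,\beta)$ is an idealized monad morphism from $\mathbb T$ to another idealized monad, then $\alpha$ preserves weak guardedness: if $f\colon X\to TY$ is weakly $\sigma$-guarded then so is $\alpha_Y\circ f$.
   Context: $\mathbb T=(T,\eta,(-)^* )$ is a monad in Kleisli-triple form. A module over $\mathbb T$ is $(M,(-)^\circ)$ with $M$ a map on objects and $(-)^\circ\colon\mathrm{Hom}(X,TY)\to\mathrm{Hom}(MX,MY)$ satisfying $\eta^\circ=\mathrm{id}$ and $g^\circ\circ f^\circ=(g^*\circ f)^\circ$ (so $M$ is a functor via $Mf=(\eta f)^\circ$). A module-to-monad morphism is a natural $m\colon M\to T$ with $m\circ f^\circ=f^*\circ m$. An idealized monad is $(\mathbb T,M,(-)^\circ,m)$. An idealized monad morphism $(\alpha,\beta)$ from $(\mathbb T,M,(-)^\circ,m)$ to $(\mathbb S,N,(-)^\bullet,m')$ consists of a monad morphism $\alpha\colon T\to S$ and a natural $\beta\colon M\to N$ with $\alpha\circ m=m'\circ\beta$ and $\beta\circ f^\circ=(\alpha\circ f)^\bullet\circ\beta$. A morphism $f\colon X\to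 T(Y+Z)$ is guarded if it factors through $[\eta\circ\mathrm{inl},m]\colon Y+M(Y+Z)\to T(Y+Z)$; $\mathbb T$ is completely iterative if every guarded $f\colon X\to T(Y+X)$ has a unique solution. For a summand $\sigma\colon Z\triangleleft Y$ (a pair exhibiting $Y$ as coproduct, identified with its first injection) with complement $\bar\sigma\colon Y'\triangleleft Y$, $f\colon X\to TY$ is weakly $\sigma$-guarded if it factors through $[\eta\circ\bar\sigma,m_Y]^*\colon T(Y'+MY)\to TY$. A monad is abstractly guarded if it has a relation $f\colon X\to_\sigma TY$ closed under (trv) $T(\mathrm{inl})\circ f\colon X\to_{\mathrm{inr}}T(Y+Z)$ for all $f\colon X\to TY$; (par) $f\colon X\to_\sigma TZ$, $g\colon Y\to_\sigma TZ$ imply $[f,g]\colon X+Y\to_\sigma TZ$; (cmp) $f\colon X\to_{\mathrm{inr}}T(Y+Z)$, $g\colon Y\to_\sigma TV$, $h\colon Z\to TV$ imply $[g,h]^*\circ f\colon X\to_\sigma TV$. *)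

(* Defs.v *)
Set Implicit Arguments.
Unset Strict Implicit.
Unset Printing Implicit Defensive.

Declare Scope cat_scope.
Delimit Scope cat_scope with cat.
Open Scope cat_scope.

Record category := Category {
  obj :> Type;
  hom : obj -> obj -> Type;
  idm : forall X, hom X X;
  comp : forall X Y Z, hom Y Z -> hom X Y -> hom X Z;
  comp_idl : forall X Y (f : hom X Y), comp (idm Y) f = f;
  comp_idr : forall X Y (f : hom X Y), comp f (idm X) = f;
  compA : forall X Y Z W (h : hom Z W) (g : hom Y Z) (f : hom X Y),
    comp h (comp g f) = comp (comp h g) f }.

Arguments idm {c} X.

Notation "X ~> Y" := (hom X Y) (at level 90, no associativity) : cat_scope.
Notation "g ∘ f" := (comp g f) (at level 40, left associativity) : cat_scope.

Definition factors_through (C : category) (X Y Z : C)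
    (f : X ~> Z) (k : Y ~> Z) : Prop :=
  exists g : X ~> Y, f = k ∘ g.

Definition is_coproduct (C : category) (X Y S : C)
    (i : X ~> S) (j : Y ~> S) : Prop :=
  forall (W : C) (f : X ~> W) (g : Y ~> W),
    exists! h : S ~> W, h ∘ i = f /\ h ∘ j = g.

(* Finite coproducts are given by a chosen initial object and chosen binary
   coproducts. *)
Record coprodCategory := CoprodCategory {
  cat_of :> category;
  initial : cat_of;
  from_initial : forall X : cat_of, initial ~> X;
  from_initial_unique : forall (X : cat_of) (f : initial ~> X),
    f = from_initial X;
  coprod : cat_of -> cat_of -> cat_of;
  injl : forall X Y : cat_of, X ~> coprod X Y;
  injr : forall X Y : cat_of, Y ~> coprod X Y;
  copair : forall X Y Z : cat_of, (X ~> Z) -> (Y ~> Z) -> (coprod X Y ~> Z);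
  copair_injl : forall (X Y Z : cat_of) (f : X ~> Z) (g : Y ~> Z),
    copair f g ∘ injl X Y = f;
  copair_injr : forall (X Y Z : cat_of) (f : X ~> Z) (g : Y ~> Z),
    copair f g ∘ injr X Y = g;
  copair_unique : forall (X Y Z : cat_of) (f : X ~> Z) (g : Y ~> Z)
      (h : coprod X Y ~> Z),
    h ∘ injl X Y = f -> h ∘ injr X Y = g -> h = copair f g }.

Arguments injl {c} X Y.
Arguments injr {c} X Y.

Notation "X ⊕ Y" := (coprod X Y) (at level 50, left associativity) : cat_scope.
Notation "[| f , g |]" := (copair f g)
  (at level 0, f at level 99, g at level 99) : cat_scope.

(* [summand Z Y] is the type of summands sigma : Z <| Y. A complement need not
   be determined by the first injection, so a summand carries both. *)
Record summand (C : category) (Z Y : C) := Summand {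
  compl : C;
  summand_inj : Z ~> Y;
  compl_inj : compl ~> Y;
  summandP : is_coproduct summand_inj compl_inj }.

Lemma is_coproduct_inr (C : coprodCategory) (Y Z : C) :
  is_coproduct (injr Y Z) (injl Y Z).
Proof.
intros W f g; exists [| g, f |]; split.
- split; [apply copair_injr | apply copair_injl].
- intros h [hr hl]; symmetry; apply copair_unique; assumption.
Qed.

Definition inr_summand (C : coprodCategory) (Y Z : C) : summand Z (Y ⊕ Z) :=
  Summand (@is_coproduct_inr C Y Z).

Record monad (C : category) := Monad {
  mobj :> C -> C;
  eta : forall X, X ~> mobj X;
  kext : forall X Y, (X ~> mobj Y) -> (mobj X ~> mobj Y);
  kext_eta : forall X, kext (eta X) = idm (mobj X);
  kext_unit : forall X Y (f : X ~> mobj Y), kext f ∘ eta X = f;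
  kext_comp : forall X Y Z (g : Y ~> mobj Z) (f : X ~> mobj Y),
    kext g ∘ kext f = kext (kext g ∘ f) }.

Arguments eta {C} m X.

Definition monad_map (C : category) (T : monad C) (X Y : C) (f : X ~> Y) :
    T X ~> T Y :=
  kext (eta T Y ∘ f).

Record monad_module (C : category) (T : monad C) := MonadModule {
  modobj :> C -> C;
  mext : forall X Y, (X ~> T Y) -> (modobj X ~> modobj Y);
  mext_eta : forall X, mext (eta T X) = idm (modobj X);
  mext_comp : forall X Y Z (g : Y ~> T Z) (f : X ~> T Y),
    mext g ∘ mext f = mext (kext g ∘ f) }.

Arguments mext {C T} m [X Y] f.

Definition module_map (C : category) (T : monad C) (M : monad_module T)
    (X Y : C) (f : X ~> Y) : M X ~> M Y :=
  mext M (eta T Y ∘ f).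

Arguments module_map {C T} M [X Y] f.

Record idealized_monad (C : category) := IdealizedMonad {
  imonad :> monad C;
  imodule : monad_module imonad;
  imor : forall X, imodule X ~> imonad X;
  imor_nat : forall X Y (f : X ~> Y),
    imor Y ∘ module_map imodule f = monad_map imonad f ∘ imor X;
  imor_mext : forall X Y (f : X ~> imonad Y),
    imor Y ∘ mext imodule f = kext f ∘ imor X }.

Arguments imor {C} i X.

Record monad_morphism (C : category) (T S : monad C) := MonadMorphism {
  mmor :> forall X, T X ~> S X;
  mmor_nat : forall X Y (f : X ~> Y),
    mmor Y ∘ monad_map T f = monad_map S f ∘ mmor X;
  mmor_eta : forall X, mmor X ∘ eta T X = eta S X;
  mmor_kext : forall X Y (f : X ~> T Y),
    mmor Y ∘ kext f = kext (mmor Y ∘ f) ∘ mmor X }.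

Record idealized_morphism (C : category) (I J : idealized_monad C) :=
  IdealizedMorphism {
    ialpha : monad_morphism I J;
    ibeta : forall X, imodule I X ~> imodule J X;
    ibeta_nat : forall X Y (f : X ~> Y),
      ibeta Y ∘ module_map (imodule I) f = module_map (imodule J) f ∘ ibeta X;
    ialpha_imor : forall X, ialpha X ∘ imor I X = imor J X ∘ ibeta X;
    ibeta_mext : forall X Y (f : X ~> I Y),
      ibeta Y ∘ mext (imodule I) f = mext (imodule J) (ialpha Y ∘ f) ∘ ibeta X }.

Definition guarded (C : coprodCategory) (I : idealized_monad C) (X Y Z : C)
    (f : X ~> I (Y ⊕ Z)) : Prop :=
  factors_through f [| eta I (Y ⊕ Z) ∘ injl Y Z, imor I (Y ⊕ Z) |].

Definition is_solution (C : coprodCategory) (T : monad C) (X Y : C)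
    (f : X ~> T (Y ⊕ X)) (s : X ~> T Y) : Prop :=
  s = kext [| eta T Y, s |] ∘ f.

Definition completely_iterative (C : coprodCategory) (I : idealized_monad C) :
    Prop :=
  forall (X Y : C) (f : X ~> I (Y ⊕ X)),
    guarded f -> exists! s : X ~> I Y, is_solution f s.

Definition weakly_guarded (C : coprodCategory) (I : idealized_monad C)
    (X Y Z : C) (sigma : summand Z Y) (f : X ~> I Y) : Prop :=
  factors_through f (kext [| eta I Y ∘ compl_inj sigma, imor I Y |]).

Record abstract_guardedness (C : coprodCategory) (T : monad C)
    (G : forall X Y Z : C, summand Z Y -> (X ~> T Y) -> Prop) : Prop :=
  AbstractGuardedness {
    guarded_trv : forall (X Y Z : C) (f : X ~> T Y),
      G X (Y ⊕ Z) Z (inr_summand Y Z) (monad_map T (injl Y Z) ∘ f);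
    guarded_par : forall (X Y Z Z' : C) (sigma : summand Z' Z)
        (f : X ~> T Z) (g : Y ~> T Z),
      G X Z Z' sigma f -> G Y Z Z' sigma g ->
      G (X ⊕ Y) Z Z' sigma [| f, g |];
    guarded_cmp : forall (X Y Z V V' : C) (sigma : summand V' V)
        (f : X ~> T (Y ⊕ Z)) (g : Y ~> T V) (h : Z ~> T V),
      G X (Y ⊕ Z) Z (inr_summand Y Z) f -> G Y V V' sigma g ->
      G X V V' sigma (kext [| g, h |] ∘ f) }.

(* Main.v *)
(** Closure under composition rests on [h^* ∘ m = m ∘ h°]: a Kleisli extension
    applied after [m] again factors through [m].

    For the iteration part, let [f = [eta ∘ inl, m]^* ∘ g] with
    [g : X -> T(Y + W)] and [W = M(Y + X)].  The solutions [s] of [f] correspond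
    bijectively to the solutions [t : W -> T Y] of
    [e := [eta ∘ inl, g]^* ∘ m : W -> T(Y + W)], via [t = [eta, s]^* ∘ m] and
    [s = [eta, t]^* ∘ g].  Since [e = m ∘ [eta ∘ inl, g]°], it is guarded. *)
Require Import Defs.

Set Implicit Arguments.
Unset Strict Implicit.
Unset Printing Implicit Defensive.

Lemma comp_copair (C : coprodCategory) (X Y Z W : C)
    (h : Z ~> W) (f : X ~> Z) (g : Y ~> Z) :
  h ∘ [| f, g |] = [| h ∘ f, h ∘ g |].
Proof.
apply copair_unique; rewrite <- compA.
- now rewrite copair_injl.
- now rewrite copair_injr.
Qed.

Lemma kext_kext_comp (C : category) (T : monad C) (X Y Z W : C)
    (g : Y ~> T Z) (f : X ~> T Y) (h : W ~> T X) :
  kext g ∘ (kext f ∘ h) = kext (kext g ∘ f) ∘ h.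
Proof. now rewrite compA, kext_comp. Qed.

Lemma kext_eta_comp (C : category) (T : monad C) (X Y W : C)
    (f : X ~> T Y) (h : W ~> X) :
  kext f ∘ (eta T X ∘ h) = f ∘ h.
Proof. now rewrite compA, kext_unit. Qed.

Lemma kext_copair_eta_injl (C : coprodCategory) (T : monad C) (X Y Z : C)
    (f : X ~> T Z) (g : Y ~> T Z) :
  kext [| f, g |] ∘ (eta T (X ⊕ Y) ∘ injl X Y) = f.
Proof. now rewrite kext_eta_comp, copair_injl. Qed.

Lemma kext_copair_eta_injr (C : coprodCategory) (T : monad C) (X Y Z : C)
    (f : X ~> T Z) (g : Y ~> T Z) :
  kext [| f, g |] ∘ (eta T (X ⊕ Y) ∘ injr X Y) = g.
Proof. now rewrite kext_eta_comp, copair_injr. Qed.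

Section WeakGuardedness.

Variables (C : coprodCategory) (I : idealized_monad C).

Lemma weakly_guarded_trv (X Y Z : C) (f : X ~> I Y) :
  weakly_guarded (inr_summand Y Z) (monad_map I (injl Y Z) ∘ f).
Proof.
(* The complement of [inr] is [inl], so [f] is sent into the left summand of [Y ⊕ M (Y ⊕ Z)], on
   which the copairing is [eta ∘ inl]. *)
exists (monad_map I (injl Y (imodule I (Y ⊕ Z))) ∘ f); simpl.
unfold monad_map.
now rewrite kext_kext_comp, kext_copair_eta_injl.
Qed.

Lemma weakly_guarded_par (X Y Z Z' : C) (sigma : summand Z' Z)
    (f : X ~> I Z) (g : Y ~> I Z) :
  weakly_guarded sigma f -> weakly_guarded sigma g ->
  weakly_guarded sigma [| f, g |].
Proof.
intros [f' ->] [g' ->]; exists [| f', g' |].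
now rewrite comp_copair.
Qed.

Lemma weakly_guarded_cmp (X Y Z V V' : C) (sigma : summand V' V)
    (f : X ~> I (Y ⊕ Z)) (g : Y ~> I V) (h : Z ~> I V) :
  weakly_guarded (inr_summand Y Z) f -> weakly_guarded sigma g ->
  weakly_guarded sigma (kext [| g, h |] ∘ f).
Proof.
intros [f' ->] [g' Eg]; simpl.
(* On [Y] the factor [g'] of [g] is used; on [M (Y ⊕ Z)] the extension by [[| g, h |]] is moved
   inside [imor] and so lands in the summand [M V]. *)
exists (kext [| g', eta I _ ∘ (injr _ _ ∘ mext (imodule I) [| g, h |]) |] ∘ f').
rewrite !kext_kext_comp, !comp_copair, kext_copair_eta_injl, kext_eta_comp.
now rewrite compA, copair_injr, <- Eg, imor_mext.
Qed.

Lemma weakly_guarded_abstract :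
  abstract_guardedness (T := I) (@weakly_guarded C I).
Proof.
split.
- exact weakly_guarded_trv.
- exact weakly_guarded_par.
- exact weakly_guarded_cmp.
Qed.

Lemma imor_comp_guarded (X Y Z : C) (h : X ~> imodule I (Y ⊕ Z)) :
  guarded (I := I) (imor I (Y ⊕ Z) ∘ h).
Proof.
exists (injr Y (imodule I (Y ⊕ Z)) ∘ h).
now rewrite compA, copair_injr.
Qed.

Lemma weakly_guarded_unique_solution (X Y : C) (f : X ~> I (Y ⊕ X)) :
  completely_iterative I -> weakly_guarded (inr_summand Y X) f ->
  exists! s : X ~> I Y, is_solution f s.
Proof.
intros ci [g ->]; simpl in g |- *.
set (inl_g := [| eta I _ ∘ injl _ _, g |]).
(* Complete iterativity is applied to [e] in its visibly guarded form [imor ∘ mext inl_g];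
   [imor_mext] then turns it into [kext inl_g ∘ imor]. *)
destruct (ci _ _ _ (imor_comp_guarded (mext (imodule I) inl_g)))
  as [t [t_sol t_uniq]].
unfold is_solution in *; rewrite imor_mext in t_sol, t_uniq.
(* Unfolding [f] once is the round trip from [s] to [t] and back; [unfold_e] is the opposite round
   trip. *)
assert (unfold_f : forall s : X ~> I Y,
    kext [| eta I Y, s |]
      ∘ (kext [| eta I (Y ⊕ X) ∘ injl Y X, imor I (Y ⊕ X) |] ∘ g) =
    kext [| eta I Y, kext [| eta I Y, s |] ∘ imor I (Y ⊕ X) |] ∘ g).
{ intros s; now rewrite kext_kext_comp, comp_copair, kext_copair_eta_injl. }
assert (unfold_e : forall u : imodule I (Y ⊕ X) ~> I Y,
    kext [| eta I Y, u |] ∘ (kext inl_g ∘ imor I (Y ⊕ X)) =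
    kext [| eta I Y, kext [| eta I Y, u |] ∘ g |] ∘ imor I (Y ⊕ X)).
{ intros u; unfold inl_g.
  now rewrite kext_kext_comp, comp_copair, kext_copair_eta_injl. }
exists (kext [| eta I Y, t |] ∘ g); split.
- now rewrite unfold_f, <- unfold_e, <- t_sol.
- intros s s_sol; rewrite unfold_f in s_sol.
  (* Any solution [s] of [f] yields a solution of [e], which must be [t]; this determines [s]. *)
  rewrite (t_uniq (kext [| eta I Y, s |] ∘ imor I (Y ⊕ X))).
  + now symmetry.
  + now rewrite unfold_e, <- s_sol.
Qed.

Lemma idealized_morphism_weakly_guarded (J : idealized_monad C)
    (ab : idealized_morphism I J) (X Y Z : C) (sigma : summand Z Y)
    (f : X ~> I Y) :
  weakly_guarded sigma f -> weakly_guarded sigma (ialpha ab Y ∘ f).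
Proof.
intros [g ->].
(* This factor is [id + ibeta] lifted along [J], after [ialpha ∘ g]: [ialpha] preserves [eta] and
   turns [imor I] into [imor J ∘ ibeta]. *)
exists (kext [| eta J _ ∘ injl _ _, eta J _ ∘ (injr _ _ ∘ ibeta ab Y) |]
          ∘ (ialpha ab _ ∘ g)).
rewrite compA, mmor_kext, <- compA, kext_kext_comp, !comp_copair.
rewrite kext_copair_eta_injl, kext_eta_comp.
now rewrite !compA, copair_injr, mmor_eta, ialpha_imor.
Qed.

End WeakGuardedness.

Theorem theorem3p17 (C : coprodCategory) (I : idealized_monad C) :
  abstract_guardedness (T := I) (@weakly_guarded C I) /\
  (completely_iterative I ->
     forall (X Y : C) (f : X ~> I (Y ⊕ X)),
       weakly_guarded (inr_summand Y X) f ->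
       exists! s : X ~> I Y, s = kext [| eta I Y, s |] ∘ f) /\
  (forall (J : idealized_monad C) (ab : idealized_morphism I J)
     (X Y Z : C) (sigma : summand Z Y) (f : X ~> I Y),
       weakly_guarded sigma f -> weakly_guarded sigma (ialpha ab Y ∘ f)).
Proof.
split; [exact (weakly_guarded_abstract I) | split].
- intros ci X Y f; exact (weakly_guarded_unique_solution ci).
- intros J ab X Y Z sigma f.
  exact (@idealized_morphism_weakly_guarded _ _ J ab X Y Z sigma f).
Qed.
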